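(* Let $n\ge 2$ and suppose $T_1'$ and $T_2'$ are $n$-leaf binary trees with a common parse word. Let $1\le i\le n$. Let $T_1$ be obtained from $T_1'$ by attaching the $2$-leaf binary tree to leaf $i$, and let $T_2$ be obtained from $T_2'$ by duplicating leaf $i$. Then \[|\mathrm{ParseWords}(T_1, T_2)| = |\mathrm{ParseWords}(T_1', T_2')|.\] In particular, $T_1$ and $T_2$ have a common parse word.
   Context: A binary tree is a rooted ordered tree in which each vertex has either $0$ or $2$ children; its leaves are numbered $1,2,\dots$ from left to right. Let $G$ be the context-free grammar with start symbols $0,1,2$ and rules $0\to 12$, $0\to 21$, $1\to 02$, $1\to 20$, $2\to 01$, $2\to 10$. An $n$-leaf binary tree $T$ parses a word $w$ of length $n$ on $\{0,1,2\}$ if there is a labeling of the vertices of $T$ by $0,1,2$ such that the leaves, from left to right, are labeled with the letters of $w$, and at every internal vertex the label of the vertex together with the labels of its left and right children form a rule of $G$ (i.e. the three labels are pairwise distinct). A common parse word of two $n$-leaf trees is a word parsed by both. If $T$ parses $w$, it also parses every word obtained from $w$ by permuting the alphabet $\{0,1,2\}$. For $n$-leaf binary trees $T_1,T_2$, $\mathrm{ParseWords}(T_1,T_2)$ denotes the set of equivalence classes (under permutations of the alphabet $\{0,1,2\}$) of words parsed by both $T_1$ and $T_2$. Attaching the $2$-leaf binary tree to leaf $i$ means replacing leaf $i$ by an internal vertex whose two children are leaves. Duplicating leaf $i$ of a binary tree with at least two leaves: let $S$ be the subtree hanging from the sibling vertex of leaf $i$. Remove $S$, attach the $2$-leaf binary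 tree at the position of the sibling of leaf $i$, and reattach $S$ at the right leaf of the new $2$-leaf tree if leaf $i$ is a left child, and at the left leaf of the new $2$-leaf tree if leaf $i$ is a right child. That is, writing $(A,B)$ for the tree with left subtree $A$ and right subtree $B$ and $\bullet$ for a leaf, the subtree at the parent of leaf $i$ changes from $(\bullet,S)$ to $(\bullet,(\bullet,S))$ if leaf $i$ is a left leaf, and from $(S,\bullet)$ to $((S,\bullet),\bullet)$ if leaf $i$ is a right leaf. *)

(* Defs.v *)
From HB Require Import structures.
From mathcomp Require Import all_boot all_fingroup.

Set Implicit Arguments.
Unset Strict Implicit.
Unset Printing Implicit Defensive.

Inductive bintree : Type :=
| Leaf
| Node (l r : bintree).

Fixpoint nleaves (T : bintree) : nat :=
  if T is Node l r then nleaves l + nleaves r else 1.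

(* In [Node l r], [None] is the root, [Some (inl v)] is the vertex [v] of [l]
   and [Some (inr v)] is the vertex [v] of [r]. *)
Fixpoint vertex (T : bintree) : finType :=
  if T is Node l r then option (vertex l + vertex r)%type else unit.

Definition root_vertex (T : bintree) : vertex T :=
  match T return vertex T with
  | Leaf => tt
  | Node l r => None
  end.

Fixpoint leaf_vertices (T : bintree) : seq (vertex T) :=
  match T return seq (vertex T) with
  | Leaf => [:: tt]
  | Node l r => [seq Some (inl v) | v <- leaf_vertices l]
             ++ [seq Some (inr v) | v <- leaf_vertices r]
  end.

Definition letter := 'I_3.

(* [(a, (b, c))] stands for the rule a -> bc. *)
Definition grammar : seq (nat * (nat * nat)) :=
  [:: (0, (1, 2)); (0, (2, 1));
      (1, (0, 2)); (1, (2, 0));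
      (2, (0, 1)); (2, (1, 0))].

Definition rule (a b c : letter) : bool :=
  (val a, (val b, val c)) \in grammar.

Lemma ruleE (a b c : letter) : rule a b c = uniq [:: a; b; c].
Proof. by case: a b c => [[|[|[|?]]] ?] [[|[|[|?]]] ?] [[|[|[|?]]] ?]. Qed.

Fixpoint admissible (T : bintree) : (vertex T -> letter) -> bool :=
  match T return (vertex T -> letter) -> bool with
  | Leaf => fun _ => true
  | Node l r => fun f =>
      [&& rule (f None) (f (Some (inl (root_vertex l))))
                        (f (Some (inr (root_vertex r)))),
          admissible (fun v => f (Some (inl v)))
        & admissible (fun v => f (Some (inr v)))]
  end.

(* The label of the root is arbitrary: 0, 1 and 2 are all start symbols. *)
Definition parses (T : bintree) (w : seq letter) : bool :=
  [exists f : {ffun vertex T -> letter},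
     (map f (leaf_vertices T) == w) && admissible f].

Definition common_parse_word (T1 T2 : bintree) (w : seq letter) : bool :=
  parses T1 w && parses T2 w.

Definition word_equiv (n : nat) : rel (n.-tuple letter) :=
  fun w w' => [exists s : {perm letter}, map_tuple s w == w'].

(* Meaningful when [T1] and [T2] have [n] leaves. *)
Definition ParseWords (n : nat) (T1 T2 : bintree) : {set {set n.-tuple letter}} :=
  equivalence_partition (@word_equiv n)
    [set w : n.-tuple letter | common_parse_word T1 T2 w].

(* Leaves are numbered from 1; both operations return junk values
   unless [1 <= i <= nleaves T]. *)
Fixpoint attach_cherry (T : bintree) (i : nat) : bintree :=
  match T with
  | Leaf => Node Leaf Leaf
  | Node l r => if i <= nleaves l then Node (attach_cherry l i) r
                else Node l (attach_cherry r (i - nleaves l))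
  end.

(* [duplicate_leaf Leaf i] is also a junk value: the leaf has no sibling. *)
Fixpoint duplicate_leaf (T : bintree) (i : nat) : bintree :=
  match T with
  | Leaf => Leaf
  | Node l r =>
      if i <= nleaves l then
        if l is Leaf then Node Leaf (Node Leaf r)
        else Node (duplicate_leaf l i) r
      else
        if r is Leaf then Node (Node l Leaf) Leaf
        else Node l (duplicate_leaf r (i - nleaves l))
  end.

(* Main.v *)
(** Write [w'] for the word obtained from [w] by replacing its letters [a], [b]
    at positions [i], [i + 1] by the third letter [c]. Then [T1] parses [w] iff
    [a <> b] and [T1'] parses [w']. When [a <> b], the labels in [T2] of the
    vertices around the duplicated leaf are forced: the labels of its sibling
    and of its parent in [T2'] are [a] and [b] (in this order for a left leaf,
    in the other order for a right leaf). So [w |-> w'] is a bijection from the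
    common parse words of [T1, T2] to those of [T1', T2'], and it commutes with
    the permutations of the alphabet. *)
Require Import Defs.
From HB Require Import structures.
From mathcomp Require Import all_boot all_fingroup.

Set Implicit Arguments.
Unset Strict Implicit.
Unset Printing Implicit Defensive.

(** * Equivalence classes transported along an injection *)

Lemma equivalence_partition_imset (T T' : finType) (R : rel T) (R' : rel T')
    (f : T -> T') (D : {set T}) :
  {in D &, forall x y, R x y = R' (f x) (f y)} ->
  equivalence_partition R' (f @: D)
    = [set f @: (X : {set T}) | X in equivalence_partition R D].
Proof.
move=> RR'; rewrite /equivalence_partition -!imset_comp.
apply: eq_in_imset => x Dx /=; apply/setP => z; rewrite inE.
apply/andP/imsetP => [[/imsetP[y Dy ->] Rxy]|[y]].
  by exists y; rewrite // inE Dy RR'.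
by rewrite inE => /andP[Dy Rxy] ->; rewrite imset_f // -RR'.
Qed.

Lemma card_equivalence_partition_imset (T T' : finType) (R : rel T)
    (R' : rel T') (f : T -> T') (D : {set T}) :
  {in D &, injective f} ->
  {in D &, forall x y, R x y = R' (f x) (f y)} ->
  #|equivalence_partition R' (f @: D)| = #|equivalence_partition R D|.
Proof.
move=> f_inj RR'; rewrite (equivalence_partition_imset RR').
(* Distinct classes must have distinct images. By antisymmetry one inclusion suffices; it is stated
   for subsets of [D], where [f] is known to be injective. *)
suff sub_imset (X Y : {set T}) : X \subset D -> Y \subset D ->
    f @: X = f @: Y -> X \subset Y.
  apply: card_in_imset => X Y /imsetP[x _ ->] /imsetP[y _ ->] eqf.
  have sD z : [set t in D | R z t] \subset D.
    by apply/subsetP => t; rewrite inE => /andP[].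
  by apply/eqP; rewrite eqEsubset; apply/andP; split; apply: sub_imset.
move=> /subsetP sXD /subsetP sYD eqf; apply/subsetP => x Xx.
have : f x \in f @: Y by rewrite -eqf imset_f.
by case/imsetP => y Yy /(f_inj _ _ (sXD _ Xx) (sYD _ Yy)) ->.
Qed.

(** * Three-letter arithmetic *)

(** The three letters sum to 3, so for [a != b] this is the remaining letter; for [a = b] the value
    is junk. *)
Definition third (a b : letter) : letter := inord (3 - (a + b)).

Lemma third_uniq (a b : letter) : a != b -> uniq [:: third a b; a; b].
Proof.
rewrite /third; case: a b => [[|[|[|?]]] ?] [[|[|[|?]]] ?] //= _.
all: by rewrite !inE -!val_eqE /= inordK.
Qed.

Lemma uniq_third (a b c : letter) : uniq [:: c; a; b] -> third a b = c.
Proof.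
move=> Ucab; apply/val_inj; move: Ucab; rewrite /third.
by case: a b c => [[|[|[|?]]] ?] [[|[|[|?]]] ?] [[|[|[|?]]] ?] //= _;
  rewrite inordK.
Qed.

Lemma uniq3_pair (a b c a' b' : letter) :
  uniq [:: c; a; b] -> uniq [:: c; a'; b'] ->
  (a' = a /\ b' = b) \/ (a' = b /\ b' = a).
Proof.
move=> Ucab Ucab'; suff /orP[] : (a' == a) && (b' == b) || (a' == b) && (b' == a).
- by case/andP=> /eqP -> /eqP ->; left.
- by case/andP=> /eqP -> /eqP ->; right.
move: Ucab Ucab'.
by case: a b c a' b' => [[|[|[|?]]] ?] [[|[|[|?]]] ?] [[|[|[|?]]] ?] //=
  [[|[|[|?]]] ?] [[|[|[|?]]] ?].
Qed.

(** The local picture after a duplication: [p] is the label of the parent, [x] that of the new inner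
    vertex, [s] that of the sibling subtree. As [x] differs from [a] and [b], it is [c], and then
    both rules leave one choice for [p] and [s]. *)
Lemma letter_dup (a b c p x s : letter) : uniq [:: c; a; b] ->
  uniq [:: p; a; x] && uniq [:: x; b; s] = [&& x == c, s == a & p == b].
Proof.
case: a b c => [[|[|[|?]]] ?] [[|[|[|?]]] ?] [[|[|[|?]]] ?] // _.
all: by case: p x s => [[|[|[|?]]] ?] [[|[|[|?]]] ?] [[|[|[|?]]] ?].
Qed.

Lemma uniq3C (a b c : letter) : uniq [:: a; b; c] = uniq [:: a; c; b].
Proof. by apply/perm_uniq; rewrite perm_cons (perm_catC [:: b]). Qed.

Lemma uniq3_rot (a b c : letter) : uniq [:: a; b; c] = uniq [:: b; c; a].
Proof. by rewrite -(rot_uniq 1). Qed.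

(** * Parsing with a prescribed root label *)

(** A form of parsing without vertex labelings, suited to induction on trees: the word is cut
    according to the leaf counts of the subtrees. *)
Fixpoint derives (T : bintree) (a : letter) (w : seq letter) : bool :=
  match T with
  | Leaf => w == [:: a]
  | Node l r => [exists b, exists c, [&& uniq [:: a; b; c],
      derives l b (take (nleaves l) w) & derives r c (drop (nleaves l) w)]]
  end.

Lemma derives_nodeP (l r : bintree) (a : letter) (w : seq letter) :
  reflect (exists b c, [/\ uniq [:: a; b; c],
      derives l b (take (nleaves l) w) & derives r c (drop (nleaves l) w)])
    (derives (Node l r) a w).
Proof.
apply: (iffP existsP) => [[b /existsP[c /and3P[? ? ?]]]|[b [c [? ? ?]]]].
  by exists b, c.
by exists b; apply/existsP; exists c; apply/and3P.
Qed.

Arguments derives_nodeP {l r a w}.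

Lemma size_derives (T : bintree) (a : letter) (w : seq letter) :
  derives T a w -> size w = nleaves T.
Proof.
elim: T a w => [|l IHl r IHr] a w; first by move/eqP ->.
case/derives_nodeP => b [c [_ /IHl sl /IHr sr]].
by rewrite -(cat_take_drop (nleaves l) w) size_cat sl sr.
Qed.

(** Labels are forced from the leaves upwards, since two distinct child labels determine the label
    of their parent. *)
Lemma derives_inj (T : bintree) (a b : letter) (w : seq letter) :
  derives T a w -> derives T b w -> a = b.
Proof.
elim: T a b w => [|l IHl r IHr] a b w; first by move=> /eqP -> /eqP[].
case/derives_nodeP => a1 [a2 [Ua la ra]].
case/derives_nodeP => b1 [b2 [Ub /(IHl _ _ _ la) eb1 /(IHr _ _ _ ra) eb2]].
by move: Ua Ub; rewrite -eb1 -eb2 => /uniq_third <- /uniq_third <-.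
Qed.

Lemma derives_map (T : bintree) (s : {perm letter}) (a : letter)
    (w : seq letter) : derives T a w -> derives T (s a) (map s w).
Proof.
elim: T a w => [|l IHl r IHr] a w; first by move/eqP ->; apply/eqP.
case/derives_nodeP => b [c [Uabc dl dr]].
apply/derives_nodeP; exists (s b), (s c).
by rewrite -map_take -map_drop IHl ?IHr // (map_inj_uniq perm_inj [:: a; b; c]).
Qed.

Lemma eq_admissible (T : bintree) (f g : vertex T -> letter) :
  f =1 g -> admissible f = admissible g.
Proof.
elim: T f g => //= l IHl r IHr f g fg.
by rewrite !fg; congr [&& _, _ & _]; [apply: IHl | apply: IHr] => v; rewrite fg.
Qed.

Lemma size_leaf_vertices (T : bintree) : size (leaf_vertices T) = nleaves T.
Proof. by elim: T => //= l IHl r IHr; rewrite size_cat !size_map IHl IHr. Qed.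

(** A labeling of [Node l r] amounts to a root label and a labeling of each subtree; these are glued
    in one direction and restricted in the other. *)
Lemma derivesP (T : bintree) (a : letter) (w : seq letter) :
  reflect (exists f : vertex T -> letter,
      [/\ map f (leaf_vertices T) = w, admissible f & f (root_vertex T) = a])
    (derives T a w).
Proof.
elim: T a w => [|l IHl r IHr] a w.
  apply: (iffP eqP) => [->|[f [<- _ <-]]//].
  by exists (fun=> a).
apply: (iffP derives_nodeP) => [[b [c [Uabc]]]|[f [<-]]].
  move=> /IHl[fl [wl Al bl]] /IHr[fr [wr Ar cr]].
  exists (fun v : vertex (Node l r) => match v with
    None => a | Some (inl v) => fl v | Some (inr v) => fr v end).
  by rewrite /= map_cat -!map_comp wl wr cat_take_drop ruleE bl cr Uabc Al Ar.
case/and3P; rewrite ruleE => U Al Ar <-; do 2 eexists; split; first exact: U.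
  apply/IHl; eexists; split; [|exact: Al|by []].
  by rewrite map_cat take_size_cat -?map_comp // !size_map size_leaf_vertices.
apply/IHr; eexists; split; [|exact: Ar|by []].
by rewrite map_cat drop_size_cat -?map_comp // !size_map size_leaf_vertices.
Qed.

Lemma parsesP (T : bintree) (w : seq letter) :
  reflect (exists a, derives T a w) (parses T w).
Proof.
apply: (iffP existsP) => [[f /andP[/eqP wf Af]]|[a /derivesP[f [wf Af _]]]].
  by exists (f (root_vertex T)); apply/derivesP; exists f.
exists (finfun f); rewrite (eq_map (ffunE f)) wf eqxx.
by rewrite (eq_admissible (ffunE f)).
Qed.

Lemma size_parses (T : bintree) (w : seq letter) :
  parses T w -> size w = nleaves T.
Proof. by case/parsesP => a /size_derives. Qed.

Lemma parses_map (T : bintree) (s : {perm letter}) (w : seq letter) :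
  parses T w -> parses T (map s w).
Proof. by case/parsesP => a d; apply/parsesP; exists (s a); apply: derives_map. Qed.

(** * Leaf counts of the two operations *)

Lemma nleaves_gt0 (T : bintree) : 0 < nleaves T.
Proof. by elim: T => //= l IHl r _; rewrite addn_gt0 IHl. Qed.

Lemma nleaves_attach_cherry (T : bintree) (i : nat) :
  nleaves (attach_cherry T i) = (nleaves T).+1.
Proof.
by elim: T i => //= l IHl r IHr i; case: ifP => _ /=; rewrite ?IHl ?IHr ?addnS.
Qed.

Lemma nleaves_duplicate_leaf (T : bintree) (i : nat) :
  1 < nleaves T -> nleaves (duplicate_leaf T i) = (nleaves T).+1.
Proof.
elim: T i => // l IHl r IHr i _ /=; have := (nleaves_gt0 l, nleaves_gt0 r).
case: ifP => _ [].
  by case: l IHl => // l1 l2 IHl _ _; rewrite /= IHl //= -addn1 leq_add ?nleaves_gt0.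
case: r IHr => [|r1 r2] IHr _ _; first by rewrite /= !addn1.
by rewrite /= IHr ?addnS //= -addn1 leq_add ?nleaves_gt0.
Qed.

(** * Cutting a word beside a marked position *)

Section Splitting.

Variables (A : Type) (k : nat) (u v : seq A) (a b c : A).

Lemma take_catl1 : size u < k ->
  take k (u ++ c :: v) = u ++ c :: take (k - (size u).+1) v.
Proof. by move=> ltuk; rewrite take_cat ltnNge ltnW // -subnSK. Qed.

Lemma drop_catl1 : size u < k ->
  drop k (u ++ c :: v) = drop (k - (size u).+1) v.
Proof. by move=> ltuk; rewrite drop_cat ltnNge ltnW // -subnSK. Qed.

(** When the marked letter becomes two letters, the cut moves from [k] to [k.+1] and [v] is split as
    in [take_catl1], so old and new words decompose in parallel. *)
Lemma take_catl2 : size u < k ->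
  take k.+1 (u ++ a :: b :: v) = u ++ a :: b :: take (k - (size u).+1) v.
Proof.
move=> ltuk; have leuk := ltnW ltuk.
by rewrite take_cat ltnNge leqW // subSn // -subnSK.
Qed.

Lemma drop_catl2 : size u < k ->
  drop k.+1 (u ++ a :: b :: v) = drop (k - (size u).+1) v.
Proof.
move=> ltuk; have leuk := ltnW ltuk.
by rewrite drop_cat ltnNge leqW // subSn // -subnSK.
Qed.

Lemma drop_catr : k <= size u -> drop k (u ++ v) = drop k u ++ v.
Proof.
rewrite drop_cat leq_eqVlt => /predU1P[->|->//].
by rewrite ltnn subnn drop0 drop_size.
Qed.

End Splitting.

(** * Attaching a cherry *)

(** The root of the cherry carries the letter [c] that the old leaf had; the induction follows the
    path down to it. The leaf index is [(size u).+1] because leaves are numbered from 1. *)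
Lemma derives_attach_cherry (T : bintree) (p a b : letter) (u v : seq letter) :
  size u < nleaves T ->
  reflect (exists2 c, uniq [:: c; a; b] & derives T p (u ++ c :: v))
    (derives (attach_cherry T (size u).+1) p (u ++ a :: b :: v)).
Proof.
elim: T p u v => [|l IHl r IHr] p u v.
  case: u => // _; rewrite [attach_cherry _ _]/=.
  apply: (iffP derives_nodeP); rewrite /= ?take0 ?drop0.
    by case=> x [y [U /eqP[->] /eqP[-> ->]]]; exists p.
  by case=> c U /eqP[cE ->]; exists a, b; rewrite -cE !eqxx.
rewrite [attach_cherry _ _]/= [nleaves _]/= => ltu; case: ltnP => [ltul|leul].
  apply: (iffP derives_nodeP);
      rewrite nleaves_attach_cherry take_catl2 // drop_catl2 //.
    case=> x [y [U /(IHl _ _ _ ltul)[c Uc dl] dr]]; exists c => //.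
    by apply/derives_nodeP; exists x, y; rewrite take_catl1 // drop_catl1.
  case=> c Uc /derives_nodeP[x [y []]].
  rewrite take_catl1 // drop_catl1 // => U dl dr; exists x, y; split=> //.
  by apply/IHl => //; exists c.
have ltur : size (drop (nleaves l) u) < nleaves r.
  by rewrite size_drop ltn_subLR.
have IH := IHr _ (drop (nleaves l) u) _ ltur.
(* This turns the leaf index [(size u - nleaves l).+1] into [(size u).+1 - nleaves l], the form
   produced by [attach_cherry]. *)
rewrite size_drop -subSn // in IH.
apply: (iffP derives_nodeP); rewrite takel_cat // drop_catr //.
  case=> x [y [U dl /IH[c Uc dr]]]; exists c => //.
  by apply/derives_nodeP; exists x, y; rewrite takel_cat // drop_catr.
case=> c Uc /derives_nodeP[x [y []]].
rewrite takel_cat // drop_catr // => U dl dr; exists x, y; split=> //.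
by apply/IH; exists c.
Qed.

(** * Duplicating a leaf *)

(** The graph of [duplicate_leaf] away from its junk values, as an induction principle with two base
    cases and two descents. The index counts the leaves to the left of the duplicated one, so it
    starts at 0. *)
Inductive duplicates : bintree -> nat -> bintree -> Prop :=
| DuplicatesLeft r : duplicates (Node Leaf r) 0 (Node Leaf (Node Leaf r))
| DuplicatesRight l :
    duplicates (Node l Leaf) (nleaves l) (Node (Node l Leaf) Leaf)
| DuplicatesInl l r k l' : k < nleaves l -> nleaves l' = (nleaves l).+1 ->
    duplicates l k l' -> duplicates (Node l r) k (Node l' r)
| DuplicatesInr l r k r' : duplicates r k r' ->
    duplicates (Node l r) (nleaves l + k) (Node l r').

Lemma duplicate_leafP (T : bintree) (k : nat) :
  1 < nleaves T -> k < nleaves T -> duplicates T k (duplicate_leaf T k.+1).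
Proof.
elim: T k => // l IHl r IHr k _ /= ltk; case: ltnP => [ltkl|lelk].
  case: l IHl ltk ltkl => [_|l1 l2 IHl] _; first by case: k => // _; constructor.
  have l_gt1 : 1 < nleaves (Node l1 l2).
    by rewrite /= -addn1 leq_add ?nleaves_gt0.
  by move=> ltkl; constructor; rewrite ?nleaves_duplicate_leaf //; apply: IHl.
move: ltk; rewrite -(subnKC lelk); move: (k - _) => j.
rewrite ltn_add2l -addnS addKn; case: r IHr => [_|r1 r2 IHr ltjr].
  by case: j => // _; rewrite addn0; constructor.
constructor; apply: IHr => //.
by rewrite /= -addn1 leq_add ?nleaves_gt0.
Qed.

Lemma derives_node_leafl (r : bintree) (p a : letter) (w : seq letter) :
  reflect (exists2 s, uniq [:: p; a; s] & derives r s w)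
    (derives (Node Leaf r) p (a :: w)).
Proof.
apply: (iffP derives_nodeP) => [[x [s []]] U /eqP[->]|[s U dr]].
  by rewrite /= drop0; exists s.
by exists a, s; rewrite /= take0 drop0 eqxx.
Qed.

Lemma derives_node_leafr (l : bintree) (p a : letter) (w : seq letter) :
  reflect (exists2 s, uniq [:: p; s; a] & derives l s w)
    (derives (Node l Leaf) p (rcons w a)).
Proof.
apply: (iffP derives_nodeP) => [[s [x [U dl /eqP dr]]]|[s U dl]].
  have /rcons_inj[wE ->] :
      rcons w a = rcons (take (nleaves l) (rcons w a)) x.
    by rewrite -(cats1 _ x) -dr cat_take_drop.
  by exists s; rewrite // wE.
exists s, a; rewrite -(size_derives dl) -cats1 take_size_cat ?drop_size_cat //.
by split=> //; apply/eqP.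
Qed.

(** By [letter_dup] the new inner vertex is labeled [c], the sibling [a] and the parent [b]. *)
Lemma derives_dup_left (r : bintree) (p a b c : letter) (v : seq letter) :
  uniq [:: c; a; b] ->
  derives (Node Leaf (Node Leaf r)) p (a :: b :: v) = (p == b) && derives r a v.
Proof.
move=> Ucab; apply/derives_node_leafl/andP => [[x Ux]|[/eqP -> da]].
  case/derives_node_leafl=> s Us; have := letter_dup p x s Ucab.
  by rewrite Ux Us => /esym/and3P[_ /eqP -> ->].
exists c; first by have:= letter_dup b c a Ucab; rewrite !eqxx => /andP[].
apply/derives_node_leafl; exists a => //.
by have:= letter_dup b c a Ucab; rewrite !eqxx => /andP[].
Qed.

(** Mirror image of [derives_dup_left]: here the sibling is labeled [b] and the parent [a]. *)
Lemma derives_dup_right (l : bintree) (p a b c : letter) (u : seq letter) :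
  uniq [:: c; a; b] ->
  derives (Node (Node l Leaf) Leaf) p (rcons (rcons u a) b)
    = (p == a) && derives l b u.
Proof.
rewrite uniq3C => Ucba.
apply/derives_node_leafr/andP => [[x Ux]|[/eqP -> db]].
  case/derives_node_leafr=> s Us; have := letter_dup p x s Ucba.
  by rewrite uniq3C Ux uniq3C Us => /esym/and3P[_ /eqP -> ->].
have := letter_dup a c b Ucba; rewrite !eqxx => /andP[Uabc Ucab].
exists c; first by rewrite uniq3C.
by apply/derives_node_leafr; exists b; rewrite // uniq3C.
Qed.

(** Serves the case of a right leaf: it is the last leaf below its parent, so no letters follow it
    in the word of that subtree. *)
Lemma derives_rightmost (T : bintree) (p : letter) (u v w : seq letter) :
  size u + size w = nleaves T -> derives T p (u ++ w ++ v) -> v = [::].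
Proof.
move=> szT /size_derives; rewrite -szT !size_cat addnA -[RHS]addn0.
by move/addnI/size0nil.
Qed.

(** The parent and the sibling carry [a] and [b] in some order, so giving the single leaf the letter
    [c] respects the rule at the parent; all other labels are kept. *)
Lemma duplicates_collapse (T T' : bintree) (k : nat) (p a b c : letter)
    (u v : seq letter) :
  duplicates T k T' -> size u = k -> uniq [:: c; a; b] ->
  derives T' p (u ++ a :: b :: v) -> derives T p (u ++ c :: v).
Proof.
move=> dup szu Ucab.
elim: dup p u v szu => {T k T'} [r|l|l r k l' ltk szl' _ IH|l r k r' _ IH] p u v.
- case: u => // _; rewrite (derives_dup_left _ _ _ Ucab) => /andP[/eqP -> da].
  by apply/derives_node_leafl; exists a; rewrite // uniq3_rot.
- move=> szu d'; have v0 : v = [::].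
    by apply: (derives_rightmost (w := [:: a; b]) _ d'); rewrite /= szu -addnA.
  move: d'; rewrite v0 cats1 -cat_rcons cats1 (derives_dup_right _ _ _ Ucab).
  case/andP=> /eqP -> db; apply/derives_node_leafr; exists b => //.
  by rewrite -uniq3_rot.
- move=> szu; move: ltk; rewrite -szu => ltul.
  case/derives_nodeP => x [y []].
  rewrite szl' take_catl2 ?drop_catl2 // => U /IH dl dr.
  by apply/derives_nodeP; exists x, y; rewrite take_catl1 ?drop_catl1 ?dl.
move=> szu; have lelu : nleaves l <= size u by rewrite szu leq_addr.
case/derives_nodeP => x [y []].
rewrite takel_cat // drop_catr // => U dl /IH dr.
apply/derives_nodeP; exists x, y; rewrite takel_cat // drop_catr //; split=> //.
by apply: dr; rewrite size_drop szu addKn.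
Qed.

(** The two letters are read off the labels in [T]: sibling then parent for a left leaf, parent then
    sibling for a right leaf. *)
Lemma duplicates_expand (T T' : bintree) (k : nat) (p c : letter)
    (u v : seq letter) :
  duplicates T k T' -> size u = k -> derives T p (u ++ c :: v) ->
  exists a b, uniq [:: c; a; b] /\ derives T' p (u ++ a :: b :: v).
Proof.
move=> dup szu.
elim: dup p u v szu => {T k T'} [r|l|l r k l' ltk szl' _ IH|l r k r' _ IH] p u v.
- case: u => // _ /derives_node_leafl[a U da]; exists a, p.
  have Ucap : uniq [:: c; a; p] by rewrite -uniq3_rot.
  by rewrite (derives_dup_left _ _ _ Ucap) eqxx.
- move=> szu d; have v0 : v = [::].
    by apply: (derives_rightmost (w := [:: c]) _ d); rewrite /= szu.
  move: d; rewrite v0 cats1 => /derives_node_leafr[b U db]; exists p, b.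
  have Ucpb : uniq [:: c; p; b] by rewrite uniq3_rot.
  by rewrite -cat_rcons cats1 (derives_dup_right _ _ _ Ucpb) eqxx.
- move=> szu; move: ltk; rewrite -szu => ltul.
  case/derives_nodeP => x [y []].
  rewrite take_catl1 ?drop_catl1 // => U /(IH _ _ _ szu)[a [b [Ucab dl]]] dr.
  exists a, b; split=> //; apply/derives_nodeP; exists x, y.
  by rewrite szl' take_catl2 ?drop_catl2.
move=> szu; have lelu : nleaves l <= size u by rewrite szu leq_addr.
case/derives_nodeP => x [y []].
rewrite takel_cat // drop_catr // => U dl /IH[|a [b [Ucab dr]]].
  by rewrite size_drop szu addKn.
exists a, b; split=> //; apply/derives_nodeP; exists x, y.
by rewrite takel_cat // drop_catr.
Qed.

(** Were [a] and [b] distinct, the sibling subtree would derive one and the same word from both,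
    against [derives_inj]. The roots [p] and [q] may differ, since swapping can change labels
    above. *)
Lemma duplicates_swap (T T' : bintree) (k : nat) (p q a b : letter)
    (u v : seq letter) :
  duplicates T k T' -> size u = k ->
  derives T' p (u ++ a :: b :: v) -> derives T' q (u ++ b :: a :: v) -> a = b.
Proof.
move=> dup szu; case: (eqVneq a b) => // /third_uniq Ucab.
have Ucba : uniq [:: third a b; b; a] by rewrite uniq3C.
elim: dup p q u v szu =>
  {T k T'} [r|l|l r k l' ltk szl' _ IH|l r k r' _ IH] p q u v.
- case: u => // _; rewrite (derives_dup_left _ _ _ Ucab) => /andP[_ da].
  rewrite (derives_dup_left _ _ _ Ucba) => /andP[_].
  exact: derives_inj.
- move=> szu d; have v0 : v = [::].
    by apply: (derives_rightmost (w := [:: a; b]) _ d); rewrite /= szu -addnA.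
  move: d; rewrite v0 -!cat_rcons !cats0 (derives_dup_right _ _ _ Ucab).
  rewrite (derives_dup_right _ _ _ Ucba) => /andP[_ db] /andP[_ da].
  exact: derives_inj da db.
- move=> szu; move: ltk; rewrite -szu => ltul.
  case/derives_nodeP => x [y [_]]; rewrite szl' take_catl2 // => dl _.
  case/derives_nodeP => x' [y' [_]]; rewrite szl' take_catl2 // => dl' _.
  exact: IH dl dl'.
move=> szu; have lelu : nleaves l <= size u by rewrite szu leq_addr.
case/derives_nodeP => x [y [_ _]]; rewrite drop_catr // => dr.
case/derives_nodeP => x' [y' [_ _]]; rewrite drop_catr //.
by apply: IH dr; rewrite size_drop szu addKn.
Qed.

(** * The collapse map on common parse words *)

(** Positions are counted from 0. The default [ord0] is reached only by words of length at most
    [k.+1]. *)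
Definition collapse (k : nat) (w : seq letter) : seq letter :=
  take k w ++ third (nth ord0 w k) (nth ord0 w k.+1) :: drop k.+2 w.

Lemma collapse_cat (u v : seq letter) (a b : letter) :
  collapse (size u) (u ++ a :: b :: v) = u ++ third a b :: v.
Proof.
rewrite /collapse take_size_cat // !nth_cat ltnn ltnNge leqnSn subnn /=.
by rewrite subSnn /= drop_cat ltnNge leqW // subSn // subSnn /= drop0.
Qed.

Section ExtendTrees.

Variables (T1 T2 : bintree) (k : nat).
Hypotheses (T2_gt1 : 1 < nleaves T2) (ltk1 : k < nleaves T1)
  (ltk2 : k < nleaves T2).

Let T1e := attach_cherry T1 k.+1.
Let T2e := duplicate_leaf T2 k.+1.
Let dup : duplicates T2 k T2e := duplicate_leafP T2_gt1 ltk2.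

(** The cherry in [T1e] forces the two letters to differ, which is the condition under which [T2e]
    can be collapsed. *)
Lemma extend_inv (w : seq letter) : common_parse_word T1e T2e w ->
  exists u a b v, [/\ w = u ++ a :: b :: v, size u = k, a != b
    & common_parse_word T1 T2 (u ++ third a b :: v)].
Proof.
case/andP=> pw1 pw2; have szw : size w = (nleaves T1).+1.
  by rewrite (size_parses pw1) nleaves_attach_cherry.
have wE : w = take k w ++ nth ord0 w k :: nth ord0 w k.+1 :: drop k.+2 w.
  by rewrite -!drop_nth ?cat_take_drop // szw // leqW.
have szu : size (take k w) = k by rewrite size_takel // szw leqW // ltnW.
move: (take k w) (nth _ _ k) (nth _ _ k.+1) (drop _ w) szu wE.
move=> u a b v szu wE; exists u, a, b, v.
move: pw1 pw2; rewrite wE => /parsesP[p d1] /parsesP[q d2].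
have ltu : size u < nleaves T1 by rewrite szu.
move: d1; rewrite /T1e -szu => /(derives_attach_cherry _ _ _ _ ltu)[c Ucab d1].
split=> //; first by move: Ucab => /= /andP[_]; rewrite inE => /andP[].
rewrite (uniq_third Ucab); apply/andP; split; apply/parsesP; first by exists p.
by exists q; apply: duplicates_collapse dup szu Ucab d2.
Qed.

Lemma common_parse_word_collapse (w : seq letter) :
  common_parse_word T1e T2e w -> common_parse_word T1 T2 (collapse k w).
Proof. by case/extend_inv => u [a [b [v [-> <- _]]]]; rewrite collapse_cat. Qed.

(** A permutation sends the letter missing from a pair of distinct letters to the one missing from
    the image pair. *)
Lemma collapse_map (s : {perm letter}) (w : seq letter) :
  common_parse_word T1e T2e w -> collapse k (map s w) = map s (collapse k w).
Proof.
case/extend_inv => u [a [b [v [-> szu /third_uniq Ucab _]]]].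
rewrite map_cat -{1}szu -(size_map s) collapse_cat -szu collapse_cat map_cat /=.
move: Ucab; rewrite -(map_inj_uniq (@perm_inj _ s)).
by move=> /uniq_third ->.
Qed.

(** The collapsed word fixes everything but the order of the two letters. The cherry in [T1e]
    accepts both orders; [T2e] decides, through [duplicates_swap]. *)
Lemma collapse_inj (w w' : seq letter) :
  common_parse_word T1e T2e w -> common_parse_word T1e T2e w' ->
  collapse k w = collapse k w' -> w = w'.
Proof.
move=> cw cw'; have /andP[_ /parsesP[p d]] := cw.
have /andP[_ /parsesP[q d']] := cw'.
move: d d'; case/extend_inv: cw => u [a [b [v [-> szu ab _]]]].
case/extend_inv: cw' => u' [a' [b' [v' [-> szu' ab' _]]]] d d'.
rewrite -{1}szu -szu' !collapse_cat => /eqP.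
rewrite eqseq_cat ?szu //; case/andP=> /eqP eu /eqP[tE ev].
move: d d'; rewrite -eu -ev; have Ucab := third_uniq ab.
have := third_uniq ab'; rewrite -tE => Ucab'.
have [[-> ->] //|[-> ->]] := uniq3_pair Ucab Ucab'.
by move=> d d'; rewrite (duplicates_swap dup szu d d').
Qed.

(** [T2] dictates the two letters to insert, and the cherry in [T1e] accepts any two distinct
    letters other than the collapsed one. *)
Lemma collapse_surj (w : seq letter) : common_parse_word T1 T2 w ->
  exists2 we, common_parse_word T1e T2e we & collapse k we = w.
Proof.
case/andP=> pw1 pw2; have szw := size_parses pw1.
have wE : w = take k w ++ nth ord0 w k :: drop k.+1 w.
  by rewrite -drop_nth ?cat_take_drop // szw.
have szu : size (take k w) = k by rewrite size_takel // szw ltnW.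
move: (take k w) (nth _ _ k) (drop _ w) szu wE => u c v szu wE.
move: pw1 pw2; rewrite wE => /parsesP[p d1] /parsesP[q d2].
have [a [b [Ucab d2e]]] := duplicates_expand dup szu d2.
exists (u ++ a :: b :: v); last by rewrite -szu collapse_cat (uniq_third Ucab).
apply/andP; split; apply/parsesP; last by exists q.
exists p; rewrite /T1e -szu; apply/derives_attach_cherry; rewrite ?szu //.
by exists c.
Qed.

End ExtendTrees.

(** * Passing to classes and counting *)

Lemma common_parse_word_map (T1 T2 : bintree) (s : {perm letter})
    (w : seq letter) :
  common_parse_word T1 T2 w -> common_parse_word T1 T2 (map s w).
Proof. by case/andP=> p1 p2; rewrite /common_parse_word !parses_map. Qed.

Theorem proposition11 (n : nat) (T1' T2' T1 T2 : bintree) (i : nat) :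
  2 <= n ->
  nleaves T1' = n -> nleaves T2' = n ->
  (exists w : seq letter, common_parse_word T1' T2' w) ->
  1 <= i <= n ->
  T1 = attach_cherry T1' i ->
  T2 = duplicate_leaf T2' i ->
  #|ParseWords n.+1 T1 T2| = #|ParseWords n T1' T2'| /\
  exists w : seq letter, common_parse_word T1 T2 w.
Proof.
(* From here on [k = i - 1] is the number of leaves to the left of leaf [i]. *)
case: i => // k n_gt1 sz1 sz2 [w0 cw0] /= ltkn -> ->.
have T2_gt1 : 1 < nleaves T2' by rewrite sz2.
have ltk1 : k < nleaves T1' by rewrite sz1.
have ltk2 : k < nleaves T2' by rewrite sz2.
have surj := collapse_surj T2_gt1 ltk1 ltk2.
split; last by have [w cw _] := surj _ cw0; exists w.
(* The map [f] below is [collapse k] between tuples; on common parse words the length is right and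
   the constant default of [insubd] does not occur. *)
set T1e := attach_cherry _ _ in surj *; set T2e := duplicate_leaf _ _ in surj *.
pose f (w : n.+1.-tuple letter) : n.-tuple letter :=
  insubd (nseq_tuple n ord0) (collapse k w).
have collapseP := common_parse_word_collapse T2_gt1 ltk1 ltk2.
have fE (w : n.+1.-tuple letter) :
    common_parse_word T1e T2e w -> f w = collapse k w :> seq letter.
  move=> /collapseP/andP[/size_parses szw _].
  by rewrite val_insubd szw sz1 eqxx.
rewrite /ParseWords; set D := [set w : n.+1.-tuple _ | _].
have f_inj : {in D &, injective f}.
  move=> w w'; rewrite !inE => cw cw' /(congr1 val); rewrite /= !fE // => eqf.
  by apply/val_inj/(collapse_inj T2_gt1 ltk1 ltk2 cw cw' eqf).
have f_map (s : {perm letter}) (w : n.+1.-tuple letter) : w \in D ->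
    f (map_tuple s w) = map_tuple s (f w).
  rewrite inE => cw; apply/val_inj; rewrite /= !fE ?common_parse_word_map //.
  exact: collapse_map cw.
have fD : f @: D = [set w : n.-tuple letter | common_parse_word T1' T2' w].
  apply/setP => w; rewrite inE; apply/imsetP/idP => [[x] | cw].
    by rewrite inE => cx ->; rewrite fE //; apply: collapseP.
  have [we cwe weE] := surj _ cw.
  have szwe : size we == n.+1.
    by case/andP: cwe => /size_parses ->; rewrite nleaves_attach_cherry sz1.
  exists (Tuple szwe); first by rewrite inE.
  by apply/val_inj; rewrite /= fE.
rewrite -fD; apply/esym/card_equivalence_partition_imset => // w w' Dw Dw'.
apply/existsP/existsP => -[s /eqP sw]; exists s; apply/eqP.
  by rewrite -sw f_map.
(* Equivalence is reflected: if [s] takes [f w] to [f w'], then [map_tuple s w] and [w'] are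
   elements of [D] with the same image. *)
apply: f_inj => //; last by rewrite f_map.
by move: Dw; rewrite !inE; apply: common_parse_word_map.
Qed.
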